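(* For all integers $d\ge 4$ and $n\ge d+3$, $$M_d(n)\ \ge\ \binom{n-1}{d}+\binom{n-4}{d-2}+M_{d-3}(n-5)+2M_{d-4}(n-6).$$
   Context: For a finite set $X$, a family $\mathcal{F}\subseteq 2^X$ and a set $S\subseteq X$, the trace of $\mathcal{F}$ on $S$ is $\operatorname{Tr}_{\mathcal{F}}(S)=\{F\cap S: F\in\mathcal{F}\}$. The set $S$ is shattered by $\mathcal{F}$ if $\operatorname{Tr}_{\mathcal{F}}(S)=2^S$, and the VC-dimension $\operatorname{VC}(\mathcal{F})$ is the maximum size of a set shattered by $\mathcal{F}$. Write $[n]=\{1,\dots,n\}$ and let $\binom{X}{r}$ denote the set of all $r$-element subsets of $X$. For integers $d\ge 0$ and $n\ge d+1$ define $$M_d(n)=\max\left\{|\mathcal{F}| : \mathcal{F}\subseteq\binom{[n]}{d+1},\ \operatorname{VC}(\mathcal{F})\le d\right\}.$$ Convention: the numerical binomial coefficient $\binom{m}{r}$ is $0$ if $r<0$ or $r>m$. *)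

(* Defs.v *)
From mathcomp Require Import all_boot.

Set Implicit Arguments.
Unset Strict Implicit.
Unset Printing Implicit Defensive.

Section VCDimension.

Variable X : finType.
Implicit Types (F : {set {set X}}) (S : {set X}).

Definition trace F S : {set {set X}} := [set A :&: S | A in F].

Definition shattered F S : bool := trace F S == powerset S.

(* The empty family shatters no set; its VC-dimension is 0 here, which is
   harmless since only upper bounds VCdim F <= d are used. *)
Definition VCdim F : nat := \max_(S : {set X} | shattered F S) #|S|.

End VCDimension.

(* The ground set [n] = {1, ..., n} is rendered as 'I_n = {0, ..., n-1}. *)
Definition M (d n : nat) : nat :=
  \max_(F : {set {set 'I_n}} |
        (F \subset [set A : {set 'I_n} | #|A| == d.+1]) && (VCdim F <= d)) #|F|.

(* Main.v *)
Require Import Defs.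
From mathcomp Require Import all_boot.
From mathcomp Require Import zify.

(** The bound comes from an explicit family. A [d.+1]-uniform family has
    VC-dimension at most [d] as soon as none of its members [C] is shattered,
    that is, as soon as every [C] has a subset which is the trace on [C] of no
    member of the family.

    Fix six points 1, ..., 6 of the ground set, the core. Whether a
    [d.+1]-set [A] belongs to the family is decided mostly by its trace on the
    core. For the traces accepted by [full], every [A] is taken. There are
    1, 5, 11, 12, 6, 1 of them of sizes 1, ..., 6. The traces containing the
    point 1 are 1, 5, 10, 10, 5, 1 in number, and those meeting {1, 2, 3, 4}
    in {2, 3, 4} contribute 0, 0, 1, 2, 1, 0; so these [A] are exactly as many
    as the [d.+1]-sets containing 1 together with the [d.+1]-sets that meet a
    fixed 4-set in a fixed 3-set, namely ['C(n - 1, d) + 'C(n - 4, d - 2)]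
    ([sum_full_fibres]). Further sets are taken over three low traces: over
    {1, 4, 5} on the first five points, the rest of [A] runs over an optimal
    family [G] for [M (d - 3) (n - 5)]; over {1, 2, 3, 5} and over
    {2, 3, 4, 6} on the six points, the rest of [A] runs over one optimal
    family [H] for [M (d - 4) (n - 6)].

    A missing trace of a member [C] is sought in the form of a union of a part
    [B] of the core and a part [R] of the complement of the core
    ([unshattered_split]). Only the members whose trace on the core meets [C]
    in [B] matter for it. If all of these have more core points than [C], then
    they have fewer points than [C] off the core, and [R] can be all of [C] off
    the core. If all of them lie over the low traces that belong to [H], and [C]
    has four core points, then their parts off the core are members of [H],
    which does not shatter the part of [C] off the core, and [R] is a trace that
    [H] misses. The same works with [G] and three points when the core is cut
    down to its first five points. Some [B] of one of these kinds exists for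
    every trace that occurs; this depends on the six core points only and is a
    finite computation on bit vectors ([present_escape]). *)

(** * Shattering *)

Lemma unshatteredP {X : finType} (F : {set {set X}}) (S : {set X}) :
  reflect (exists2 R : {set X}, R \subset S & forall A, A \in F -> A :&: S <> R)
          (~~ shattered F S).
Proof.
have sTP : trace F S \subset powerset S.
  by apply/subsetP=> _ /imsetP[A _ ->]; rewrite powersetE subsetIr.
apply: (iffP idP) => [|[R sRS noR]].
  rewrite /shattered eqEsubset sTP /= => /subsetPn[R].
  rewrite powersetE => sRS R_missing; exists R => // A FA AS_R.
  by case/imsetP: R_missing; exists A.
apply/negP=> /eqP eqT; have: R \in trace F S by rewrite eqT powersetE.
by case/imsetP=> A FA eqR; case: (noR A FA).
Qed.

Lemma unshattered_VCdim {X : finType} {d} {F : {set {set X}}} {S : {set X}} :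
  VCdim F <= d -> d < #|S| -> ~~ shattered F S.
Proof.
move=> VCd ltdS; apply/negP=> shS.
have := leq_trans (leq_bigmax_cond _ shS) VCd.
by rewrite leqNgt ltdS.
Qed.

(** In a [k]-uniform family a shattered [k]-set must itself be a member, being
    the trace of a member of the same size. *)
Lemma uniform_unshattered {X : finType} {k} {F : {set {set X}}} {S : {set X}} :
  (forall A, A \in F -> #|A| = k) -> #|S| = k -> S \notin F -> ~~ shattered F S.
Proof.
move=> unif cardS notFS; apply/unshatteredP; exists S => // A FA AS.
have sSA : S \subset A by rewrite -AS subsetIl.
have eqSA : S = A by apply/eqP; rewrite eqEcard sSA (unif A FA) cardS /=.
by move: notFS; rewrite eqSA FA.
Qed.

(** A set of size above [d] which is shattered is the trace of some member,
    hence contained in it, hence equal to it by uniformity. *)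
Lemma uniform_VCdim {X : finType} {d} {F : {set {set X}}} :
  (forall A, A \in F -> #|A| = d.+1) -> (forall C, C \in F -> ~~ shattered F C) ->
  VCdim F <= d.
Proof.
move=> unif noC; apply/bigmax_leqP=> S shS; rewrite leqNgt; apply/negP=> ltdS.
have : S \in trace F S by rewrite (eqP shS) powersetE.
case/imsetP=> A FA eqS.
have cardS : #|S| = d.+1.
  by apply/eqP; rewrite eqn_leq ltdS andbT -(unif A FA) eqS subset_leq_card ?subsetIl.
have [/noC|/(uniform_unshattered unif cardS)] := boolP (S \in F); by rewrite shS.
Qed.

Lemma imset_unshattered {X Y : finType} (f : X -> Y) (F : {set {set X}}) (S : {set X}) :
  injective f -> ~~ shattered F S -> ~~ shattered [set f @: A | A : {set X} in F] (f @: S).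
Proof.
move=> f_inj /unshatteredP[R sRS noR]; apply/unshatteredP.
exists (f @: R) => [|_ /imsetP[A FA ->]]; first exact: imsetS.
by rewrite -imsetI => [/(imset_inj f_inj)|x y _ _]; [exact: noR | exact: f_inj].
Qed.

(** Transport along the enumeration of [Y]: an image of a member is unshattered
    because the member is, any other set of the same size by uniformity. *)
Lemma M_witness {X : finType} (d : nat) (Y : {set X}) :
  exists L : {set {set X}},
    [/\ #|L| = M d #|Y|,
        forall A, A \in L -> A \subset Y /\ #|A| = d.+1
      & forall C : {set X}, #|C| = d.+1 -> ~~ shattered L C].
Proof.
have [F /andP[sF VCF] cardF] : exists2 F : {set {set 'I_#|Y|}},
    (F \subset [set A : {set 'I_#|Y|} | #|A| == d.+1]) && (VCdim F <= d) & #|F| = M d #|Y|.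
  pose P (F : {set {set 'I_#|Y|}}) :=
    (F \subset [set A : {set 'I_#|Y|} | #|A| == d.+1]) && (VCdim F <= d).
  have P0 : P set0 by rewrite /P sub0set; apply: uniform_VCdim => A; rewrite inE.
  rewrite /M (bigmax_eq_arg _ P0).
  by case: arg_maxnP => // F PF _; exists F.
have unifF A : A \in F -> #|A| = d.+1.
  by move/(subsetP sF); rewrite inE => /eqP.
have f_inj := @enum_val_inj X (mem Y).
set f := @enum_val X (mem Y) in f_inj.
exists [set f @: A | A : {set 'I_#|Y|} in F].
have unifL A : A \in [set f @: A | A : {set 'I_#|Y|} in F] -> #|A| = d.+1.
  by case/imsetP=> B FB ->; rewrite card_imset // unifF.
split=> [|A LA|C cardC].
- by rewrite card_imset //; apply: imset_inj.
- split; last exact: unifL.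
  by case/imsetP: LA => B _ ->; apply/subsetP=> _ /imsetP[i _ ->]; apply: enum_valP.
have [/imsetP[B FB eqC]|] := boolP (C \in [set f @: A | A : {set 'I_#|Y|} in F]).
  by rewrite eqC imset_unshattered // (unshattered_VCdim VCF) ?unifF.
exact: uniform_unshattered unifL cardC.
Qed.

Lemma leq_M {n d} {F : {set {set 'I_n}}} :
  (forall A, A \in F -> #|A| = d.+1) -> (forall C, C \in F -> ~~ shattered F C) ->
  #|F| <= M d n.
Proof.
move=> unif noC; apply: (leq_bigmax_cond (F := fun F : {set {set 'I_n}} => #|F|)).
by rewrite uniform_VCdim // andbT; apply/subsetP=> A FA; rewrite inE unif.
Qed.

(** A trace [B] on [C :&: K] and a trace [R] on [C :\: K] combine into a missing
    trace on [C] if [R] is missed by those members that realise [B]. *)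
Lemma unshattered_split {X : finType} {F L : {set {set X}}} {C K B : {set X}} :
  B \subset C :&: K ->
  (forall A, A \in F -> A :&: C :&: K = B -> A :\: K \in L) ->
  ~~ shattered L (C :\: K) -> ~~ shattered F C.
Proof.
move=> sB FL /unshatteredP[R sR noR]; apply/unshatteredP; exists (B :|: R).
  rewrite subUset (subset_trans sB) ?subsetIl //=.
  by rewrite (subset_trans sR) ?subsetDl.
move=> A FA AC.
have B_K x : x \in B -> x \in K by move/(subsetP sB); rewrite inE => /andP[].
have R_K x : x \in R -> x \in K = false.
  by move/(subsetP sR); rewrite inE => /andP[/negPf].
apply: (noR (A :\: K)); last first.
  apply/setP=> x; move/setP/(_ x): AC; rewrite !inE.
  case: (boolP (x \in K)) => [Kx _|Kx] /=; last first.
    by move->; case: (boolP (x \in B)) => // /B_K; rewrite (negPf Kx).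
  by apply/esym/negP=> /R_K; rewrite Kx.
apply: FL => //; rewrite AC; apply/setP=> x; rewrite !inE.
case: (boolP (x \in B)) => [/B_K-> //|_] /=.
by case: (boolP (x \in R)) => [/R_K-> |].
Qed.

(** * Codes of sets on a core *)

Definition code {X : finType} (c : seq X) (A : {set X}) : bitseq :=
  [seq x \in A | x <- c].

Definition meet (s t : bitseq) : bitseq := [seq p.1 && p.2 | p <- zip s t].

Fixpoint bitseqs (k : nat) : seq bitseq :=
  if k is j.+1 then map (cons true) (bitseqs j) ++ map (cons false) (bitseqs j)
  else [:: [::]].

Lemma mem_bitseqs k (s : bitseq) : (s \in bitseqs k) = (size s == k).
Proof.
elim: k s => [|k IHk] [|b s] //=; rewrite mem_cat.
  by apply/norP; split; apply/mapP=> -[].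
rewrite eqSS -IHk.
have inj b' : injective (cons b' : bitseq -> bitseq) by move=> ? ? [].
have neq b' (r : seq bitseq) : (~~ b' :: s \in map (cons b') r) = false.
  by apply/mapP=> -[t _ [/eqP]]; case: b'.
case: b; first by rewrite (mem_map (inj true)) (neq false) orbF.
by rewrite (mem_map (inj false)) (neq true).
Qed.

Lemma size_code {X : finType} (c : seq X) (A : {set X}) : size (code c A) = size c.
Proof. exact: size_map. Qed.

Lemma take_code {X : finType} k (c : seq X) (A : {set X}) :
  take k (code c A) = code (take k c) A.
Proof. by rewrite /code map_take. Qed.

Lemma codeI {X : finType} (c : seq X) (A B : {set X}) :
  code c (A :&: B) = meet (code c A) (code c B).
Proof. by rewrite /meet /code zip_map -map_comp; apply: eq_map => x; rewrite inE. Qed.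

Lemma count_code {X : finType} (c : seq X) (A : {set X}) :
  uniq c -> count id (code c A) = #|A :&: [set x in c]|.
Proof.
move=> uc; rewrite /code count_map -size_filter.
rewrite -(card_uniqP (filter_uniq _ uc)).
by apply: eq_card => x; rewrite !inE mem_filter.
Qed.

Lemma code_eq {X : finType} (c : seq X) (t : bitseq) (A : {set X}) :
  uniq c -> size t = size c ->
  (code c A == t) = (A :&: [set x in c] == [set x in mask t c]).
Proof.
move=> uc st; apply/eqP/eqP => [<-|/setP eqA].
  apply/setP=> x; rewrite !inE in_mask //.
  case cx: (x \in c); rewrite ?andbF //= andbT.
  by rewrite (nth_map x) ?index_mem // nth_index.
apply: (@eq_from_nth _ false) => [|i]; rewrite size_code // => lt_i.
have [x0 _] : exists x0, x0 \in c by case: (c) lt_i => // x0 *; exists x0; rewrite mem_head.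
rewrite (nth_map x0) //; have := eqA (nth x0 c i).
by rewrite !inE in_mask // mem_nth // andbT index_uniq.
Qed.

(** The members of the fibre over [t] are determined by their parts off the core,
    which may be prescribed freely. *)
Lemma card_fibre {X : finType} (c : seq X) (t : bitseq) (L : {set {set X}}) :
  uniq c -> size t = size c -> (forall R, R \in L -> R \subset ~: [set x in c]) ->
  #|[set A | (code c A == t) && (A :\: [set x in c] \in L)]| = #|L|.
Proof.
move=> uc st sL; set K := [set x in c].
have sT : [set x in mask t c] \subset K.
  by apply/subsetP=> x; rewrite !inE; apply: mem_mask.
have UK R : R \in L -> ([set x in mask t c] :|: R) :\: K = R.
  move/sL => sR; rewrite setDUl (eqP (_ : _ :\: K == set0)) ?setD_eq0 //.
  by rewrite set0U; apply/setDidPl; rewrite disjoints_subset.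
have IK R : R \in L -> ([set x in mask t c] :|: R) :&: K = [set x in mask t c].
  move/sL => sR; rewrite setIUl (setIidPl sT).
  by rewrite (_ : R :&: K = set0) ?setU0 //; apply/eqP; rewrite setI_eq0 disjoints_subset.
rewrite -(card_in_imset (f := setU [set x in mask t c]) (D := mem L)); last first.
  by move=> R1 R2 /UK {2}<- /UK {2}<- ->.
apply: eq_card => A; rewrite inE code_eq //; apply/andP/imsetP=> [[/eqP AK LA]|[R LR ->]].
  by exists (A :\: K); rewrite // -AK setID.
by rewrite UK // IK.
Qed.

Lemma card_code_mem {X : finType} (c : seq X) (s : seq bitseq) (P : pred {set X}) :
  uniq s ->
  #|[set A | (code c A \in s) && P A]| = \sum_(t <- s) #|[set A | (code c A == t) && P A]|.
Proof.
elim: s => [|t s IHs] /=.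
  by rewrite big_nil => _; apply: eq_card0 => A; rewrite !inE.
case/andP=> ts us; rewrite big_cons -IHs // -cardsUI addnC.
rewrite (_ : _ :&: _ = set0) ?cards0 ?add0n.
  by apply: eq_card => A; rewrite !inE andb_orl.
apply/setP=> A; rewrite !inE; case: eqP => [->|] //=.
by rewrite (negPf ts) andbF.
Qed.

Lemma card_uniform_fibre {X : finType} (k : nat) (c : seq X) (t : bitseq) :
  uniq c -> size t = size c -> count id t <= k ->
  #|[set A | (code c A == t) && (#|A| == k)]| = 'C(#|X| - size c, k - count id t).
Proof.
move=> uc st le_tk; set K := [set x in c].
have cardK : #|~: K| = #|X| - size c.
  by rewrite cardsCs setCK (_ : #|K| = size c) // cardsE; apply/card_uniqP.
pose L := [set R : {set X} | (R \subset ~: K) && (#|R| == k - count id t)].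
rewrite -cardK -cards_draws -/L -(card_fibre c t L) //; last first.
  by move=> R; rewrite inE => /andP[].
apply: eq_card => A; rewrite !inE; case: eqP => [At|] //=.
rewrite (_ : A :\: K \subset ~: K) /=; last by apply/subsetP=> x; rewrite !inE => /andP[].
by rewrite -(cardsID K A) -count_code // At -/K; apply/eqP/eqP; lia.
Qed.

(** * The pattern on six points *)

(** The core points are numbered from 1 to 6, in the order of the bits. *)
Definition bits (k : nat) (s : seq nat) : bitseq := [seq i \in s | i <- iota 1 k].

Definition low5 : bitseq := bits 5 [:: 1; 4; 5].

Definition low6 : seq bitseq := map (bits 6) [:: [:: 1; 2; 3; 5]; [:: 2; 3; 4; 6]].

(** Compared with the traces that contain the point 1, the pairs {1, 4} and
    {1, 5} are replaced by {2, 4} and {2, 5}, and after further exchanges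
    there are one triple, two 4-sets and one 5-set more. The 4-set {1, 4, 5, 6} is
    excluded because [low5] covers it. *)
Definition full (t : bitseq) : bool :=
  match count id t with
  | 0 => false
  | 1 => t \in map (bits 6) [:: [:: 1]]
  | 2 => t \in map (bits 6) [:: [:: 1; 2]; [:: 1; 3]; [:: 1; 6]; [:: 2; 4]; [:: 2; 5]]
  | 3 => t \in map (bits 6)
      [:: [:: 1; 2; 3]; [:: 1; 2; 4]; [:: 1; 2; 5]; [:: 1; 2; 6]; [:: 1; 3; 4];
          [:: 1; 3; 6]; [:: 2; 3; 4]; [:: 2; 4; 5]; [:: 2; 4; 6]; [:: 2; 5; 6];
          [:: 3; 4; 5]]
  | 4 => t \notin bits 6 [:: 1; 4; 5; 6] :: low6
  | _ => true
  end.

Definition present (t : bitseq) : bool :=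
  [|| full t, take 5 t == low5 | t \in low6].

Definition classes : seq bitseq := [seq t <- bitseqs 6 | present t].

(** Here [b] is the core part of a missing trace, and [good] is what suffices to
    rule out the members that realise [b]. *)
Definition escape (k : nat) (t : bitseq) (good : pred bitseq) : bool :=
  has (fun b => (meet b (take k t) == b) &&
         all (fun u => (meet (take k u) (take k t) == b) ==> good u) classes)
      (bitseqs k).

(** The three ways for a set with trace [t] to miss a trace: the members that
    realise [b] have too many core points to cover the set off the core, or they
    come from [G], or they come from [H]. The conditions on [count id] make the
    set off the core have the cardinality of the members of [G] or [H]. For [G]
    the core consists of the first five points. *)
Lemma present_escape (t : bitseq) : t \in classes ->
  [|| escape 6 t (fun u => count id t < count id u),
      (count id (take 5 t) == 3) && escape 5 t (fun u => take 5 u == low5)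
    | (count id t == 4) && escape 6 t (fun u => u \in low6)].
Proof. by move: t; apply/allP; vm_compute. Qed.

(** Hence the part off the core of a member with a low trace is in [G] or [H], as
    that trace prescribes. *)
Lemma pattern_exclusive (u : bitseq) : size u = 6 ->
  (take 5 u == low5) + (u \in low6) + full u <= 1.
Proof.
move=> su.
have : all (fun u => (take 5 u == low5) + (u \in low6) + full u <= 1) (bitseqs 6).
  by vm_compute.
by move/allP/(_ u); rewrite mem_bitseqs su => /(_ isT).
Qed.

Lemma escapeP {X : finType} {k} {c : seq X} {C : {set X}} {good} :
  uniq c -> size c = 6 -> k <= 6 -> escape k (code c C) good ->
  exists2 B : {set X}, B \subset C :&: [set x in take k c] &
    forall A, code c A \in classes -> A :&: C :&: [set x in take k c] = B ->
      good (code c A).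
Proof.
move=> uc sc k6 /hasP[b]; rewrite mem_bitseqs => /eqP sb /andP[/eqP bC /allP all_u].
have uck : uniq (take k c) by rewrite take_uniq.
have sck : size b = size (take k c) by rewrite size_takel ?sc.
set K := [set x in _]; have sBK : [set x in mask b (take k c)] \subset K.
  by apply/subsetP=> x; rewrite !inE; apply: mem_mask.
have codeB : code (take k c) [set x in mask b (take k c)] = b.
  by apply/eqP; rewrite code_eq // (setIidPl sBK).
exists [set x in mask b (take k c)] => [|A /all_u/implyP good_A /eqP eqB].
  move: bC; rewrite take_code -{1}codeB -codeI => /eqP.
  by rewrite code_eq // -setIA => /eqP/setIidPl.
move: eqB; rewrite -code_eq // codeI => /eqP eqb.
by apply: good_A; rewrite !take_code eqb eqxx.
Qed.

(** * The family *)

(** Over [low5] the sixth core point is part of the ground set of [G]. *)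
Definition family {X : finType} (d : nat) (c : seq X) (G H : {set {set X}}) :
    {set {set X}} :=
  [set A : {set X} | (#|A| == d.+1) &&
    [|| full (code c A),
        (code (take 5 c) A == low5) && (A :\: [set x in take 5 c] \in G)
      | (code c A \in low6) && (A :\: [set x in c] \in H)]].

Lemma family_unshattered {X : finType} (d : nat) (c : seq X) (G H : {set {set X}}) :
  uniq c -> size c = 6 -> 4 <= d ->
  (forall C : {set X}, #|C| = (d - 3).+1 -> ~~ shattered G C) ->
  (forall C : {set X}, #|C| = (d - 4).+1 -> ~~ shattered H C) ->
  forall C, C \in family d c G H -> ~~ shattered (family d c G H) C.
Proof.
move=> uc sc d4 noG noH C FC; set F := family d c G H.
have c6 : take 6 c = c by rewrite take_oversize ?sc.
have cardF A : A \in F -> #|A| = d.+1 by rewrite inE => /andP[/eqP].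
have presF A : A \in F -> code c A \in classes.
  rewrite inE mem_filter mem_bitseqs size_code sc andbT /present take_code => /andP[_].
  by case/or3P=> [->|/andP[-> _]|/andP[-> _]]; rewrite ?orbT.
have splitA (A K : {set X}) : A \in F -> #|A :\: K| = d.+1 - #|A :&: K|.
  by move=> FA; rewrite cardsD cardF.
case/or3P: (present_escape _ (presF C FC))
  => [|/andP[/eqP C3]|/andP[/eqP C4]] /(escapeP uc sc) []// B.
- rewrite c6 => sB good.
  apply: (unshattered_split (L := [set R : {set X} | #|R| < #|C :\: [set x in c]|]) sB).
    move=> A FA AB; have := good A (presF A FA) AB.
    have := subset_leq_card (subsetIl A [set x in c]); rewrite (cardF A FA).
    by rewrite !count_code // inE !splitA //; lia.
  (* Smaller sets do not cover the part of [C] off the core. *)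
  apply/unshatteredP; exists (C :\: [set x in c]) => // R; rewrite inE ltnNge => /negP leCR RC.
  by apply: leCR; rewrite -{1}RC subset_leq_card ?subsetIl.
- move=> sB good; apply: (unshattered_split (L := G) sB); last first.
    by apply: noG; rewrite splitA // -count_code ?take_uniq // -take_code C3; lia.
  move=> A FA AB; have lowA := good A (presF A FA) AB.
  have := pattern_exclusive _ (etrans (size_code c A) sc); rewrite lowA.
  move: FA; rewrite inE -take_code lowA => /andP[_].
  by case: (full _); case: (_ \in low6) => //=; rewrite orbF.
- rewrite c6 => sB good; apply: (unshattered_split (L := H) sB); last first.
    by apply: noH; rewrite splitA // -count_code // C4; lia.
  move=> A FA AB; have lowA := good A (presF A FA) AB.
  have := pattern_exclusive _ (etrans (size_code c A) sc); rewrite lowA.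
  move: FA; rewrite inE -take_code lowA => /andP[_].
  by case: (full _); case: (_ == low5).
Qed.

(** On the left the coefficients of the binomials by trace size are
    1, 5, 11, 12, 6, 1; on the right Pascal's rule expands the two binomials to
    the same ones. The bound on [count id t] keeps the truncated subtraction from
    counting a set over the trace of size six when members have size five. *)
Lemma sum_full_fibres (d m : nat) : 4 <= d ->
  \sum_(t <- bitseqs 6 | full t && (count id t <= d.+1)) 'C(m, d.+1 - count id t)
    = 'C(m + 5, d) + 'C(m + 2, d - 2).
Proof.
move=> d4; pose w d s := if s <= d.+1 then 'C(m, d.+1 - s) else 0.
transitivity (\sum_(s <- [seq count id t | t <- bitseqs 6 & full t]) w d s).
  by rewrite big_map big_filter big_mkcondr.
set s := map _ _; vm_compute in s; rewrite {}/s !big_cons big_nil.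
have {d4} [e ->] : exists e, d = e + 4 by exists (d - 4); lia.
rewrite !addnS !addn0 /w /= !subSS !subn0 !binS.
(* For [e = 0] the trace of size six contributes nothing. *)
by case: e => [|e]; rewrite ?binS ?bin0 ?subn1 /=; lia.
Qed.

Lemma card_family {X : finType} (d : nat) (c : seq X) (G H : {set {set X}}) :
  uniq c -> size c = 6 -> 4 <= d ->
  (forall R, R \in G -> R \subset ~: [set x in take 5 c] /\ #|R| = (d - 3).+1) ->
  (forall R, R \in H -> R \subset ~: [set x in c] /\ #|R| = (d - 4).+1) ->
  #|family d c G H| =
    'C(#|X| - 6 + 5, d) + 'C(#|X| - 6 + 2, d - 2) + #|G| + 2 * #|H|.
Proof.
move=> uc sc d4 subG subH; set K := [set x in c]; set K5 := [set x in take 5 c].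
have uc5 : uniq (take 5 c) by rewrite take_uniq.
have sc5 : size (take 5 c) = 5 by rewrite size_takel ?sc.
pose F1 := [set A | (code c A \in filter full (bitseqs 6)) && (#|A| == d.+1)].
pose F2 := [set A | (code (take 5 c) A == low5) && (A :\: K5 \in G)].
pose F3 := [set A | (code c A \in low6) && (A :\: K \in H)].
have inF1 A : (A \in F1) = full (code c A) && (#|A| == d.+1).
  by rewrite inE (mem_filter full) mem_bitseqs size_code sc andbT.
have excl A := pattern_exclusive _ (etrans (size_code c A) sc).
have card2 A : A \in F2 -> #|A| = d.+1.
  rewrite inE => /andP[/eqP A5 /subG[_ cardA]].
  by rewrite -(cardsID K5 A) cardA -count_code // A5 /=; lia.
have card3 A : A \in F3 -> #|A| = d.+1.
  rewrite inE => /andP[A6 /subH[_ cardA]].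
  have A4 : count id (code c A) = 4.
    by apply/eqP; move: A6; apply/allP: (code c A); vm_compute.
  by rewrite -(cardsID K A) cardA -count_code // A4; lia.
have eqF : family d c G H = F1 :|: (F2 :|: F3).
  apply/setP=> A; rewrite 2!in_setU inF1 !in_set.
  case: (eqVneq #|A| d.+1) => [_|nA] /=; first by rewrite andbT.
  rewrite andbF /=; apply/esym/negP=> /orP[A2|A3].
    by case/eqP: nA; apply: card2; rewrite inE.
  by case/eqP: nA; apply: card3; rewrite inE.
have disj12 : F1 :&: (F2 :|: F3) = set0.
  apply/setP=> A; rewrite in_setI in_setU inF1 !in_set -take_code.
  by move: (excl A); case: (_ == low5); case: (_ \in low6); case: (full _) => //=; rewrite ?andbF.
have disj23 : F2 :&: F3 = set0.
  apply/setP=> A; rewrite !in_set -take_code.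
  by move: (excl A); case: (_ == low5); case: (_ \in low6) => //=; rewrite ?andbF.
have card_F1 : #|F1| = 'C(#|X| - 6 + 5, d) + 'C(#|X| - 6 + 2, d - 2).
  rewrite card_code_mem; last by vm_compute.
  rewrite -sum_full_fibres // [RHS]big_mkcondr -[RHS]big_filter; apply: eq_big_seq => t.
  rewrite mem_filter mem_bitseqs => /andP[_ /eqP st].
  case: leqP => [le_td|lt_dt]; first by rewrite -sc card_uniform_fibre ?sc.
  apply: eq_card0 => A; rewrite !inE; apply/negP=> /andP[/eqP At /eqP cardA].
  by move: lt_dt; rewrite -At count_code // -cardA ltnNge subset_leq_card ?subsetIl.
have card_F2 : #|F2| = #|G|.
  by apply: card_fibre => // R /subG[].
have card_F3 : #|F3| = 2 * #|H|.
  rewrite card_code_mem; last by vm_compute.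
  have card_low t : size t = 6 -> #|[set A | (code c A == t) && (A :\: K \in H)]| = #|H|.
    by move=> st; apply: card_fibre; rewrite ?sc // => R /subH[].
  by rewrite !big_cons big_nil !card_low // addn0 mul2n addnn.
rewrite eqF cardsU disj12 cards0 subn0 cardsU disj23 cards0 subn0.
by rewrite card_F1 card_F2 card_F3 addnA.
Qed.

Theorem corollary3p3 (d n : nat) (hd : 4 <= d) (hn : d + 3 <= n) :
  'C(n - 1, d) + 'C(n - 4, d - 2) + M (d - 3) (n - 5) + 2 * M (d - 4) (n - 6)
    <= M d n.
Proof.
pose c : seq 'I_n := take 6 (enum 'I_n).
have sc : size c = 6 by rewrite size_takel // size_enum_ord; lia.
have uc : uniq c by rewrite take_uniq // enum_uniq.
have card_off k : k <= 6 -> #|~: [set x in take k c]| = n - k.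
  move=> k6; rewrite cardsCs setCK card_ord cardsE.
  by rewrite (card_uniqP (take_uniq _ uc)) size_takel ?sc.
have [G [cardG unifG noG]] := M_witness (d - 3) (~: [set x in take 5 c]).
have [H [cardH unifH noH]] := M_witness (d - 4) (~: [set x in take 6 c]).
rewrite card_off // in cardG; rewrite card_off // in cardH.
have c6 : take 6 c = c by rewrite take_oversize ?sc.
rewrite c6 in unifH.
have unifF A : A \in family d c G H -> #|A| = d.+1 by rewrite inE => /andP[/eqP].
apply: leq_trans (leq_M unifF (family_unshattered d c G H uc sc hd noG noH)).
rewrite card_family // card_ord cardG cardH.
by have [-> ->] : n - 1 = n - 6 + 5 /\ n - 4 = n - 6 + 2 by lia.
Qed.
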